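(* There exists a continuous map $\widetilde S:\mathbb{K}^2\to\mathbb{K}^2$ of the Klein bottle which is fiber-preserving, minimal, and not invertible.
   Context: $\mathbb{T}^1=\mathbb{R}/\mathbb{Z}$ and $\mathbb{T}^2=\mathbb{T}^1\times\mathbb{T}^1$. Let $P:\mathbb{T}^2\to\mathbb{T}^2$, $P(x,y)=(x+\tfrac12,\,1-y)$. The Klein bottle is $\mathbb{K}^2=\mathbb{T}^2/\!\sim$, where each $(x,y)$ is identified with $P(x,y)$; $\pi:\mathbb{T}^2\to\mathbb{K}^2$ is the quotient map. The fibers of $\mathbb{K}^2$ are the circles $\pi(\{x\}\times\mathbb{T}^1)$, $x\in\mathbb{T}^1$ (note $\pi(\{x\}\times\mathbb{T}^1)=\pi(\{x+\tfrac12\}\times\mathbb{T}^1)$). A map is fiber-preserving if it maps each fiber into a fiber. A continuous map $f:X\to X$ of a compact metric space is minimal if there is no nonempty closed set $X'\neq X$ with $f(X')\subseteq X'$. *)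

(* Defs.v *)
From Stdlib Require Import Reals ZArith.
Open Scope R_scope.

(* Points of the universal cover R^2 of the Klein bottle.  K^2 = R^2 / G where
   G is generated by (x,y) |-> (x, y+1) and (x,y) |-> (x + 1/2, -y)
   (this is T^2 / P with T^2 = R^2/Z^2, P(x,y) = (x+1/2, 1-y)).
   Every element of G has the form act k n below. *)
Definition pt := (R * R)%type.

Definition act (k n : Z) (p : pt) : pt :=
  (fst p + IZR k / 2, (if Z.even k then snd p else - snd p) + IZR n).

Definition kequiv (p q : pt) : Prop := exists k n : Z, q = act k n p.

(* the flat quotient distance between [p] and [q] is < eps *)
Definition kclose (eps : R) (p q : pt) : Prop :=
  exists k n : Z,
    let r := act k n q in
    (fst p - fst r) ^ 2 + (snd p - snd r) ^ 2 < eps ^ 2.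

Definition kmap (f : pt -> pt) : Prop :=
  forall p q, kequiv p q -> kequiv (f p) (f q).

Definition kcontinuous (f : pt -> pt) : Prop :=
  forall p eps, 0 < eps -> exists delta, 0 < delta /\
    forall q, kclose delta p q -> kclose eps (f p) (f q).

(* p, q lie on the same fiber pi({x} x T^1) = pi({x+1/2} x T^1) *)
Definition same_fiber (p q : pt) : Prop := exists k : Z, fst q = fst p + IZR k / 2.

Definition fiber_preserving (f : pt -> pt) : Prop :=
  forall p q, same_fiber p q -> same_fiber (f p) (f q).

(* subsets of K^2 = saturated predicates on pt *)
Definition saturated (A : pt -> Prop) : Prop :=
  forall p q, kequiv p q -> A p -> A q.

Definition kclosed (A : pt -> Prop) : Prop :=
  forall p, ~ A p -> exists eps, 0 < eps /\ forall q, kclose eps p q -> ~ A q.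

Definition minimal (f : pt -> pt) : Prop :=
  forall A : pt -> Prop, saturated A -> kclosed A -> (exists p, A p) ->
    (forall p, A p -> A (f p)) -> forall p, A p.

Definition invertible (f : pt -> pt) : Prop :=
  exists g : pt -> pt, kmap g /\
    forall p, kequiv (g (f p)) p /\ kequiv (f (g p)) p.

(* Main.v *)
Require Import Defs.
From Stdlib Require Import Reals ZArith Lra Lia ClassicalEpsilon.
From Coquelicot Require Import Hierarchy Rcomplements Series Continuity.

(** Start from a minimal skew rotation [(x, y) |-> (x + sqrt 2, y + g x)] with
    [g (x + 1/2) = - g x]; here [g] is a series of coboundaries of triangular waves of odd
    frequency [q_j], where [q_j sqrt 2] is so close to an integer that the series converges,
    while its Birkhoff sums follow the large partial sums of the waves.

    Now blow up the backward orbit of [(0, 0)] to vertical segments. A point over [(x, y)] is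
    a sequence [e], where [e n] solves an equation attached to the [n]-th forward iterate of
    [(x, y)]; the solution is unique unless that iterate is [(0, 0)] (or [(1/2, 0)]), in which
    case it fills a segment. The fibre coordinate is [t = y + sum_n e_n / 2^(n+1)], so shifting
    [e] becomes the map [t |-> 2 t - (y + e_0) + g x], which collapses the segment over
    [(0, 0)] since it forgets [e_0]. Minimality is inherited from the skew rotation, because
    all fibres without a segment are contained in any closed invariant set, and they are
    dense. *)

(** * The distance to the nearest integer and the triangular wave *)

Definition dZ (s : R) : R := Rabs (s - IZR (Int_part (s + 1/2))).

Lemma dZ_attained s : exists k : Z, dZ s = Rabs (s - IZR k) /\ dZ s <= 1/2.
Proof.
exists (Int_part (s + 1/2)); split; [reflexivity|].
unfold dZ; destruct (base_Int_part (s + 1/2)) as [H1 H2].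
apply Rabs_le; lra.
Qed.

Lemma dZ_le s k : dZ s <= Rabs (s - IZR k).
Proof.
destruct (dZ_attained s) as [l [E H]].
destruct (Z.eq_dec k l) as [->|N]; [lra|].
apply Rle_trans with (1 := H).
assert (K : 1 <= Rabs (IZR k - IZR l)).
{ rewrite <- minus_IZR, <- abs_IZR. apply (IZR_le 1). lia. }
rewrite E in H.
replace (IZR k - IZR l) with ((s - IZR l) - (s - IZR k)) in K by ring.
generalize (Rabs_triang (s - IZR l) (- (s - IZR k))).
rewrite Rabs_Ropp. unfold Rminus in *. lra.
Qed.

Lemma dZ_eq s k : Rabs (s - IZR k) <= 1/2 -> dZ s = Rabs (s - IZR k).
Proof.
intros H. apply Rle_antisym; [apply dZ_le|].
destruct (dZ_attained s) as [l [E H']].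
destruct (Z.eq_dec k l) as [->|N]; [lra|].
assert (K : 1 <= Rabs (IZR k - IZR l)).
{ rewrite <- minus_IZR, <- abs_IZR. apply (IZR_le 1). lia. }
rewrite E in *.
replace (IZR k - IZR l) with ((s - IZR l) - (s - IZR k)) in K by ring.
generalize (Rabs_triang (s - IZR l) (- (s - IZR k))).
rewrite Rabs_Ropp. unfold Rminus in *. lra.
Qed.

Lemma dZ_bounds s : 0 <= dZ s <= 1/2.
Proof. destruct (dZ_attained s) as [k [E H]]. split; [apply Rabs_pos | exact H]. Qed.

Lemma dZ_lip s s' : Rabs (dZ s' - dZ s) <= Rabs (s' - s).
Proof.
assert (L : forall a b, dZ b - dZ a <= Rabs (b - a)).
{ intros a b. destruct (dZ_attained a) as [k [E _]].
  generalize (dZ_le b k) (Rabs_triang (b - a) (a - IZR k)).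
  replace (b - a + (a - IZR k)) with (b - IZR k) by ring. lra. }
generalize (L s s') (L s' s). rewrite (Rabs_minus_sym s s').
intros; apply Rabs_le; lra.
Qed.

Lemma dZ_periodic s k : dZ (s + IZR k) = dZ s.
Proof.
destruct (dZ_attained s) as [l [E H]].
rewrite E in *. rewrite (dZ_eq _ (l + k)); rewrite plus_IZR;
  replace (s + IZR k - (IZR l + IZR k)) with (s - IZR l) by ring; lra.
Qed.

Lemma dZ_half s : dZ (s + 1/2) = 1/2 - dZ s.
Proof.
destruct (dZ_attained s) as [k [E H]]. rewrite E in *.
destruct (Rle_dec (IZR k) s) as [K|K].
- rewrite Rabs_pos_eq in * by lra.
  rewrite (dZ_eq _ (k + 1)); rewrite plus_IZR, Rabs_left1; lra.
- rewrite Rabs_left1 in * by lra.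
  rewrite (dZ_eq _ k); rewrite Rabs_pos_eq; lra.
Qed.

Lemma dZ_opp s : dZ (- s) = dZ s.
Proof.
destruct (dZ_attained s) as [k [E H]].
rewrite E in *.
rewrite (dZ_eq _ (- k)); rewrite opp_IZR;
  replace (- s - - IZR k) with (- (s - IZR k)) by ring; rewrite Rabs_Ropp; lra.
Qed.

Lemma dZ_zero s : dZ s = 0 -> exists k, s = IZR k.
Proof.
intros H. destruct (dZ_attained s) as [k [E _]]. exists k.
destruct (Req_dec (s - IZR k) 0) as [|N]; [lra|].
apply Rabs_no_R0 in N. lra.
Qed.

(** The wave of period 1 and slopes 1 and -1 that is the identity on [-1/4, 1/4]. It is odd and
    changes sign under [s + 1/2], as the glide reflection requires. *)
Definition tri (s : R) : R := dZ (s + 1/4) - 1/4.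

Lemma tri_bound s : Rabs (tri s) <= 1/4.
Proof. unfold tri. generalize (dZ_bounds (s + 1/4)). intros; apply Rabs_le; lra. Qed.

Lemma tri_lip s s' : Rabs (tri s' - tri s) <= Rabs (s' - s).
Proof.
unfold tri. generalize (dZ_lip (s + 1/4) (s' + 1/4)).
replace (s' + 1/4 - (s + 1/4)) with (s' - s) by ring.
replace (dZ (s' + 1/4) - 1/4 - (dZ (s + 1/4) - 1/4))
  with (dZ (s' + 1/4) - dZ (s + 1/4)) by ring. trivial.
Qed.

Lemma tri_id s : Rabs s <= 1/4 -> tri s = s.
Proof.
intros H. apply Rabs_le_between in H. unfold tri.
rewrite (dZ_eq _ 0); rewrite Rabs_pos_eq; lra.
Qed.

Lemma tri_periodic s k : tri (s + IZR k) = tri s.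
Proof.
unfold tri. replace (s + IZR k + 1/4) with (s + 1/4 + IZR k) by ring.
now rewrite dZ_periodic.
Qed.

Lemma tri_half s : tri (s + 1/2) = - tri s.
Proof.
unfold tri. replace (s + 1/2 + 1/4) with (s + 1/4 + 1/2) by ring.
rewrite dZ_half. field.
Qed.

Lemma tri_opp s : tri (- s) = - tri s.
Proof.
rewrite <- tri_half. unfold tri. rewrite <- (dZ_opp (- s + 1/4)).
rewrite <- (dZ_periodic _ 1). do 2 f_equal. simpl; lra.
Qed.

(** The sign by which [act k n] acts on the vertical coordinate. *)
Definition sgn (k : Z) : R := if Z.even k then 1 else -1.

Lemma sgn_cases k : sgn k = 1 \/ sgn k = -1.
Proof. unfold sgn. destruct (Z.even k); auto. Qed.

Lemma act_sgn k n x y : act k n (x, y) = (x + IZR k / 2, sgn k * y + IZR n).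
Proof. unfold act, sgn; simpl. destruct (Z.even k); f_equal; ring. Qed.

Lemma tri_halves s k : tri (s + IZR k / 2) = sgn k * tri s.
Proof.
unfold sgn. destruct (Z.even k) eqn:E.
- apply Z.even_spec in E as [m ->]. rewrite mult_IZR.
  replace (2 * IZR m / 2) with (IZR m) by field.
  rewrite tri_periodic; ring.
- assert (O : Z.odd k = true) by (rewrite <- Z.negb_even, E; reflexivity).
  apply Z.odd_spec in O as [m ->]. rewrite plus_IZR, mult_IZR.
  replace (s + (2 * IZR m + 1) / 2) with (s + 1/2 + IZR m) by field.
  rewrite tri_periodic, tri_half; ring.
Qed.

Lemma tri_sgn k s : tri (sgn k * s) = sgn k * tri s.
Proof.
destruct (sgn_cases k) as [-> | ->]; [now rewrite !Rmult_1_l|].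
replace (-1 * s) with (- s) by ring. rewrite tri_opp; ring.
Qed.

(** * The rotation by [sqrt 2] *)

Definition alpha : R := sqrt 2.

Lemma alpha_sqr : alpha * alpha = 2.
Proof. apply sqrt_sqrt; lra. Qed.

Lemma alpha_bounds : 5/4 < alpha < 3/2.
Proof. generalize alpha_sqr (sqrt_pos 2). fold alpha. split; nra. Qed.

(* The odd powers of [sqrt 2 - 1] are [q * sqrt 2 - p] with [q] odd. *)
Lemma odd_approximations (j : nat) : exists q p : Z,
  Z.odd q = true /\ (Z.of_nat j <= q)%Z /\ (0 < q)%Z /\ (0 <= p)%Z /\
  0 < IZR q * alpha - IZR p <= (1/2) ^ j.
Proof.
induction j as [|j (q & p & O & J & Q & P & D1 & D2)].
- exists 1%Z, 1%Z. generalize alpha_bounds. repeat split; try lia; simpl; lra.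
(* Multiplication by (sqrt 2 - 1)^2 = 3 - 2 sqrt 2, which is below 1/2 because [alpha > 5/4]. *)
- exists (3 * q + 2 * p)%Z, (4 * q + 3 * p)%Z.
  split; [|split; [lia|split; [lia|split; [lia|]]]].
  { rewrite Z.odd_add, !Z.odd_mul, O. reflexivity. }
  rewrite !plus_IZR, !mult_IZR.
  replace ((3 * IZR q + 2 * IZR p) * alpha - (4 * IZR q + 3 * IZR p))
    with ((IZR q * alpha - IZR p) * (3 - 2 * alpha) + 2 * IZR q * (alpha * alpha - 2)) by ring.
  rewrite alpha_sqr. generalize alpha_bounds. simpl. split; nra.
Qed.

Lemma half_pow_small eps : 0 < eps -> exists N, forall n, (N <= n)%nat -> (1/2) ^ n < eps.
Proof.
intros H. destruct (pow_lt_1_zero (1/2)) with (y := eps) as [N HN]; trivial.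
{ rewrite Rabs_pos_eq; lra. }
exists N. intros n Hn. specialize (HN n Hn).
rewrite Rabs_pos_eq in HN; trivial. apply pow_le; lra.
Qed.

Lemma INR_above x : exists n, x < INR n.
Proof.
destruct (INR_unbounded x) as [n H]. now exists n.
Qed.

Lemma odd_approximation (B eta : R) : 0 < eta -> exists q p : Z,
  Z.odd q = true /\ B <= IZR q /\ 1 <= IZR q /\ 0 < IZR q * alpha - IZR p < eta.
Proof.
intros H. destruct (half_pow_small eta H) as [N HN], (INR_above B) as [N' HN'].
destruct (odd_approximations (N + N')) as (q & p & O & J & Q & P & D).
exists q, p. specialize (HN (N + N')%nat ltac:(lia)).
assert (INR N' <= IZR q).
{ rewrite INR_IZR_INZ. apply IZR_le. lia. }
assert (1 <= IZR q) by (apply (IZR_le 1); lia).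
repeat split; trivial; lra.
Qed.

(** Otherwise [n * (q * alpha - p)] would be an integer for all [q], [p], while a good approximation
    puts it strictly between 0 and 1. *)
Lemma alpha_irrational (n : Z) (k : Z) : (0 < n)%Z -> IZR n * alpha <> IZR k.
Proof.
intros Hn E. assert (Hn' := IZR_lt 0 n Hn).
destruct (odd_approximation 0 (/ IZR n)) as (q & p & _ & _ & _ & D1 & D2).
{ now apply Rinv_0_lt_compat. }
assert (E' : IZR n * (IZR q * alpha - IZR p) = IZR (k * q - n * p)).
{ rewrite minus_IZR, !mult_IZR, <- E. ring. }
assert (0 < IZR (k * q - n * p)) by (rewrite <- E'; nra).
assert (IZR (k * q - n * p) < 1).
{ rewrite <- E', <- (Rinv_r (IZR n)) by lra. now apply Rmult_lt_compat_l. }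
apply lt_IZR in H. apply lt_IZR in H0. lia.
Qed.

(** A block of [q] rotations moves by some [d] in (0, eta) modulo 1, so fewer than 1/d + 1 blocks go
    once around the circle. The bound [M] is thus uniform in the two points. *)
Lemma rotation_dense eta : 0 < eta -> exists M : nat, forall x x', exists (m : nat) (k : Z),
  (m <= M)%nat /\ Rabs (x + INR m * alpha - x' - IZR k) < eta.
Proof.
intros H. destruct (odd_approximation 0 eta H) as (q & p & _ & _ & Q & D1 & D2).
set (d := IZR q * alpha - IZR p) in *.
destruct (INR_above (/ d)) as [N HN].
exists (N * Z.to_nat q)%nat. intros x x'.
set (r := frac_part (x' - x)). set (j := Int_part (r / d)).
assert (Hr : 0 <= r < 1) by (unfold r; destruct (base_fp (x' - x)); lra).
assert (Hid : 0 < / d) by now apply Rinv_0_lt_compat.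
assert (Hrd : 0 <= r / d < INR N) by (unfold Rdiv; nra).
destruct (base_Int_part (r / d)) as [J1 J2]; fold j in J1, J2.
assert (J0 : (0 <= j)%Z).
{ apply Z.lt_succ_r. apply lt_IZR. unfold Z.succ. rewrite plus_IZR. lra. }
assert (JN : (j <= Z.of_nat N)%Z).
{ apply le_IZR. rewrite <- INR_IZR_INZ. lra. }
assert (Q0 : (0 < q)%Z) by (apply lt_IZR; lra).
exists (Z.to_nat j * Z.to_nat q)%nat, (j * p - Int_part (x' - x))%Z. split.
{ apply Nat.mul_le_mono_r. lia. }
rewrite mult_INR, !INR_IZR_INZ, !Z2Nat.id by lia.
rewrite minus_IZR, mult_IZR.
replace (x + IZR j * IZR q * alpha - x' - (IZR j * IZR p - IZR (Int_part (x' - x))))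
  with (- (r - IZR j * d)) by (unfold r, frac_part, d; ring).
rewrite Rabs_Ropp.
replace (r - IZR j * d) with ((r / d - IZR j) * d) by (field; lra).
rewrite Rabs_pos_eq; nra.
Qed.

(** * Dyadic series *)

(** A weighted mean, the weights having sum 1. It serves twice: for the sum over the waves and for
    the vertical coordinate of the blow-up. *)
Definition dy (a : nat -> R) : R := Series (fun n => a n * (1/2) ^ (S n)).

Definition bdd (B : R) (a : nat -> R) : Prop := forall n, Rabs (a n) <= B.

Lemma is_series_half : is_series (fun n => (1/2) ^ (S n)) 1.
Proof.
assert (H : is_series (fun n => (1/2) ^ n) (/ (1 - 1/2))).
{ apply is_series_geom. rewrite Rabs_pos_eq; lra. }
apply (is_series_scal_l (1/2)) in H.
change (is_series (fun n => (1/2) ^ (S n)) (1/2 * / (1 - 1/2))) in H.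
now replace (1/2 * / (1 - 1/2)) with 1 in H by field.
Qed.

Lemma dy_ex B a : bdd B a -> ex_series (fun n => a n * (1/2) ^ (S n)).
Proof.
intros H. apply (ex_series_le (K := R_AbsRing) (V := R_CompleteNormedModule)) with (b := fun n => B * (1/2) ^ (S n)).
- intros n. unfold norm; simpl. unfold abs; simpl.
  rewrite Rabs_mult, (Rabs_pos_eq ((1/2) * _)).
  + apply Rmult_le_compat_r; [|apply H]. apply (pow_le (1/2) (S n)); lra.
  + apply (pow_le (1/2) (S n)); lra.
- apply (ex_series_scal_l (K := R_AbsRing) B (fun n => (1/2) ^ (S n))). eexists; apply is_series_half.
Qed.

Lemma dy_const c : dy (fun _ => c) = c.
Proof.
unfold dy. rewrite Series_scal_l, (is_series_unique _ _ is_series_half). ring.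
Qed.

Lemma dy_plus A B a b : bdd A a -> bdd B b -> dy (fun n => a n + b n) = dy a + dy b.
Proof.
intros Ha Hb. unfold dy. rewrite <- Series_plus by (eapply dy_ex; eassumption).
apply Series_ext; intros n; ring.
Qed.

Lemma dy_scal c a : dy (fun n => c * a n) = c * dy a.
Proof. unfold dy. rewrite <- Series_scal_l. apply Series_ext; intros n; ring. Qed.

Lemma dy_ext a b : (forall n, a n = b n) -> dy a = dy b.
Proof. intros H. apply Series_ext; intros n; now rewrite H. Qed.

Lemma bdd_plus A B a b : bdd A a -> bdd B b -> bdd (A + B) (fun n => a n + b n).
Proof.
intros Ha Hb n. generalize (Rabs_triang (a n) (b n)) (Ha n) (Hb n). lra.
Qed.

Lemma bdd_scal c A a : bdd A a -> bdd (Rabs c * A) (fun n => c * a n).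
Proof. intros Ha n. rewrite Rabs_mult. apply Rmult_le_compat_l; [apply Rabs_pos | apply Ha]. Qed.

Lemma bdd_const c : bdd (Rabs c) (fun _ => c).
Proof. intros n; lra. Qed.

Lemma bdd_minus A B a b : bdd A a -> bdd B b -> bdd (A + B) (fun n => a n - b n).
Proof.
intros Ha Hb n. generalize (Rabs_triang (a n) (- b n)) (Ha n) (Hb n).
rewrite Rabs_Ropp. unfold Rminus. lra.
Qed.

Lemma dy_minus A B a b : bdd A a -> bdd B b -> dy (fun n => a n - b n) = dy a - dy b.
Proof.
intros Ha Hb. rewrite (dy_ext _ (fun n => a n + -1 * b n)) by (intros; ring).
rewrite (dy_plus A (Rabs (-1) * B)), dy_scal; trivial; [ring|].
now apply bdd_scal.
Qed.

(** This self-similarity of the weights is why shifting a sequence becomes an explicit map of its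
    mean. *)
Lemma dy_shift B a : bdd B a -> dy a = a O / 2 + dy (fun n => a (S n)) / 2.
Proof.
intros H. unfold dy at 1. rewrite Series_incr_1 by now apply dy_ex with B.
rewrite (Series_ext _ (fun n => 1/2 * (a (S n) * (1/2) ^ (S n)))) by (intros; simpl; ring).
rewrite Series_scal_l. unfold dy. simpl. field.
Qed.

Lemma dy_ge B m a : bdd B a -> (forall n, m <= a n) -> m <= dy a.
Proof.
intros Ha H.
assert (K : 0 <= dy (fun n => a n - m)).
{ unfold dy. rewrite <- (Rmult_0_l (Series (fun n => (1/2) ^ (S n)))), <- Series_scal_l.
  apply Series_le.
  - intros n. assert (0 <= (1/2) ^ (S n)) by (apply pow_le; lra). specialize (H n). nra.
  - eapply dy_ex, (bdd_minus B (Rabs m)); [exact Ha | apply bdd_const]. }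
rewrite (dy_minus B (Rabs m)), dy_const in K; [lra | exact Ha | apply bdd_const].
Qed.

Lemma dy_bound B a : bdd B a -> Rabs (dy a) <= B.
Proof.
intros H. apply Rabs_le. split.
- apply dy_ge with B; trivial. intros n. generalize (H n). intros K; apply Rabs_le_between in K; lra.
- assert (K : - B <= dy (fun n => -1 * a n)).
  { apply dy_ge with (Rabs (-1) * B); [now apply bdd_scal|].
    intros n. generalize (H n). intros K; apply Rabs_le_between in K; lra. }
  rewrite dy_scal in K. lra.
Qed.

Lemma dy_lower B (N : nat) a eta : bdd B a -> 0 <= eta -> (forall n, -1 <= a n) ->
  (forall n, (n < N)%nat -> - eta <= a n) -> - eta - (1/2) ^ N <= dy a.
Proof.
revert a. induction N as [|N IH]; intros a Ha He H1 H2.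
- simpl. apply dy_ge with B; trivial. intros n. generalize (H1 n); lra.
- rewrite (dy_shift B) by trivial.
  assert (K := IH (fun n => a (S n)) (fun n => Ha (S n)) He (fun n => H1 (S n))
    (fun n Hn => H2 (S n) ltac:(lia))).
  generalize (H2 O ltac:(lia)). simpl. lra.
Qed.

(** One large entry cannot be hidden by the others: it contributes its full weight, while the
    remaining entries lose at most [eta] before [N] and their total weight after [N]. *)
Lemma dy_lower_except B (N n0 : nat) a eta d : bdd B a -> 0 <= eta -> (forall n, -1 <= a n) ->
  (n0 < N)%nat -> (forall n, (n < N)%nat -> n <> n0 -> - eta <= a n) -> d <= a n0 ->
  d * (1/2) ^ (S n0) - eta - (1/2) ^ N <= dy a.
Proof.
revert n0 a. induction N as [|N IH]; intros n0 a Ha He H1 Hn H2 Hd; [lia|].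
rewrite (dy_shift B) by trivial.
destruct n0 as [|n0].
- assert (K := dy_lower B N (fun n => a (S n)) eta (fun n => Ha (S n)) He (fun n => H1 (S n))
    (fun n Hn => H2 (S n) ltac:(lia) ltac:(lia))).
  simpl. lra.
- assert (K := IH n0 (fun n => a (S n)) (fun n => Ha (S n)) He (fun n => H1 (S n)) ltac:(lia)
    (fun n Hn Hn' => H2 (S n) ltac:(lia) ltac:(lia)) Hd).
  generalize (H2 O ltac:(lia) ltac:(lia)). simpl in *. lra.
Qed.

Lemma dy_close eps : 0 < eps -> exists (N : nat) eta, 0 < eta /\ forall a b,
  bdd (1/4) a -> bdd (1/4) b -> (forall n, (n < N)%nat -> Rabs (b n - a n) <= eta) ->
  Rabs (dy b - dy a) < eps.
Proof.
intros H. destruct (half_pow_small (eps / 2)) as [N HN]; [lra|].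
exists N, (eps / 2). split; [lra|].
assert (L : forall a b, bdd (1/4) a -> bdd (1/4) b ->
  (forall n, (n < N)%nat -> Rabs (b n - a n) <= eps / 2) -> - eps < dy b - dy a).
{ intros a b Ha Hb K. rewrite <- (dy_minus (1/4) (1/4)) by trivial.
  specialize (HN N (Nat.le_refl _)).
  assert (- (eps / 2) - (1/2) ^ N <= dy (fun n => b n - a n)); [|lra].
  apply dy_lower with (1/4 + 1/4); try lra; [now apply bdd_minus| |].
  - intros n. assert (A := Ha n). assert (B := Hb n).
    apply Rabs_le_between in A. apply Rabs_le_between in B. lra.
  - intros n Hn. specialize (K n Hn). apply Rabs_le_between in K. lra. }
intros a b Ha Hb K. apply Rabs_def1.
- generalize (L b a Hb Ha). intros X.
  assert (- eps < dy a - dy b); [|lra]. apply X. intros n Hn. rewrite Rabs_minus_sym. now apply K.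
- now apply L.
Qed.

(** * A skew rotation all of whose orbits are dense *)

(** The order of choice matters: [q] is taken after [L] and [M], and [M'] only then, for the
    Lipschitz constant that includes the new wave. *)
Lemma frequency_step (i : nat) (L : R) (M : nat) : 0 <= L -> exists w : Z * Z * nat,
  let '(q, p, M') := w in
  Z.odd q = true /\ 2 ^ i <= IZR q /\ 2 ^ i * L <= IZR q /\
  0 < IZR q * alpha - IZR p /\
  2 ^ (i + 2) * (INR M + 1) * (IZR q * alpha - IZR p) <= 1 /\ (M <= M')%nat /\
  forall x x', exists (m : nat) (k : Z), (m <= M')%nat /\
    Rabs (x + INR m * alpha - x' - IZR k) < / (2 ^ i * (L + 2 * IZR q)).
Proof.
intros HL.
assert (P : 0 < 2 ^ i) by (apply pow_lt; lra).
assert (P2 : 0 < 2 ^ (i + 2)) by (apply pow_lt; lra).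
assert (HM := pos_INR M).
set (C := 2 ^ (i + 2) * (INR M + 1)).
assert (HC : 0 < C) by (unfold C; nra).
destruct (odd_approximation (2 ^ i + 2 ^ i * L) (/ C)) as (q & p & O & B & Q & D1 & D2).
{ now apply Rinv_0_lt_compat. }
destruct (rotation_dense (/ (2 ^ i * (L + 2 * IZR q)))) as [M' HM'].
{ apply Rinv_0_lt_compat. nra. }
exists (q, p, max M M'). split; [exact O|].
assert (0 <= 2 ^ i * L) by nra.
split; [lra|split; [lra|split; [lra|split; [|split; [lia|]]]]].
- fold C. rewrite <- (Rinv_r C) by lra. apply Rmult_le_compat_l; lra.
- intros x x'. destruct (HM' x x') as (m & k & Hm & K). exists m, k. split; [lia | exact K].
Qed.

(* [L i] is a Lipschitz constant of the sum of the first [i] waves. By time [M (S i)] every orbit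
   of the rotation comes so close to every point that this sum is resolved, and [q j] is chosen
   after [M j] so that the later waves have barely moved by then. *)
Record frequencies (q p : nat -> Z) (L : nat -> R) (M : nat -> nat) : Prop := {
  fr_L0 : L O = 0;
  fr_LS : forall i, L (S i) = L i + 2 * IZR (q i);
  fr_odd : forall i, Z.odd (q i) = true;
  fr_q : forall i, 2 ^ i <= IZR (q i);
  fr_qL : forall i, 2 ^ i * L i <= IZR (q i);
  fr_pos : forall i, 0 < IZR (q i) * alpha - IZR (p i);
  fr_small : forall i, 2 ^ (i + 2) * (INR (M i) + 1) * (IZR (q i) * alpha - IZR (p i)) <= 1;
  fr_M : forall i, (M i <= M (S i))%nat;
  fr_dense : forall i x x', exists (m : nat) (k : Z), (m <= M (S i))%nat /\
    Rabs (x + INR m * alpha - x' - IZR k) < / (2 ^ i * L (S i)) }.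

Lemma frequencies_exist : exists q p L M, frequencies q p L M.
Proof.
(* The condition on [L] sits under the existential, with a dummy value when it fails, so that choice
   yields a total step function. Nonnegativity is then proved along the recursion. *)
assert (F : forall a : nat * R * nat, exists w : Z * Z * nat,
  0 <= snd (fst a) -> let '(q, p, M') := w in let '(i, L, M) := a in
  Z.odd q = true /\ 2 ^ i <= IZR q /\ 2 ^ i * L <= IZR q /\
  0 < IZR q * alpha - IZR p /\
  2 ^ (i + 2) * (INR M + 1) * (IZR q * alpha - IZR p) <= 1 /\ (M <= M')%nat /\
  forall x x', exists (m : nat) (k : Z), (m <= M')%nat /\
    Rabs (x + INR m * alpha - x' - IZR k) < / (2 ^ i * (L + 2 * IZR q))).
{ intros [[i L] M]; simpl. destruct (Rle_dec 0 L) as [HL|HL].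
  - destruct (frequency_step i L M HL) as [w Hw]. now exists w.
  - exists (0%Z, 0%Z, O). intros; contradiction. }
set (G a := proj1_sig (constructive_indefinite_description _ (F a))).
assert (HG : forall a, _) by (intros a; exact (proj2_sig (constructive_indefinite_description _ (F a)))).
fold (G) in HG.
set (st := fix st (i : nat) : R * nat := match i with
  | O => (0, O)
  | S j => let (L, M) := st j in let '(q, p, M') := G (j, L, M) in (L + 2 * IZR q, M') end).
set (L i := fst (st i)). set (M i := snd (st i)).
set (q i := fst (fst (G (i, L i, M i)))). set (p i := snd (fst (G (i, L i, M i)))).
assert (LS : forall i, L (S i) = L i + 2 * IZR (q i)).
{ intros i. unfold L, q, M, L; simpl. destruct (st i) as [l m]; simpl.
  now destruct (G (i, l, m)) as [[q0 p0] m0]. }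
assert (MS : forall i, M (S i) = snd (G (i, L i, M i))).
{ intros i. unfold L, M; simpl. destruct (st i) as [l m]; simpl.
  now destruct (G (i, l, m)) as [[q0 p0] m0]. }
assert (HL : forall i, 0 <= L i).
{ induction i as [|i IH]; [apply Rle_refl|]. rewrite LS.
  generalize (HG (i, L i, M i) IH). fold (G (i, L i, M i)). unfold q. simpl.
  destruct (G (i, L i, M i)) as [[q0 p0] m0]; simpl.
  intros (_ & A & _). assert (0 < 2 ^ i) by (apply pow_lt; lra). lra. }
assert (All : forall i, Z.odd (q i) = true /\ 2 ^ i <= IZR (q i) /\ 2 ^ i * L i <= IZR (q i) /\
  0 < IZR (q i) * alpha - IZR (p i) /\
  2 ^ (i + 2) * (INR (M i) + 1) * (IZR (q i) * alpha - IZR (p i)) <= 1 /\ (M i <= M (S i))%nat /\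
  forall x x', exists (m : nat) (k : Z), (m <= M (S i))%nat /\
    Rabs (x + INR m * alpha - x' - IZR k) < / (2 ^ i * (L i + 2 * IZR (q i)))).
{ intros i. generalize (HG (i, L i, M i) (HL i)). fold (G (i, L i, M i)).
  rewrite MS. unfold p, q. now destruct (G (i, L i, M i)) as [[q0 p0] m0]. }
exists q, p, L, M. split; try (intros i; destruct (All i) as (?&?&?&?&?&?&?); assumption); trivial.
intros i. rewrite LS. now destruct (All i) as (?&?&?&?&?&?&?).
Qed.

(** The factor 2 gives the range [-1/2, 1/2], so a single wave attains every value modulo 1. *)
Definition wave (q : nat -> Z) (j : nat) (x : R) : R := 2 * tri (IZR (q j) * x).

Fixpoint waves (q : nat -> Z) (k : nat) (x : R) : R :=
  match k with O => 0 | S j => waves q j x + wave q j x end.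

(* The [n]-th Birkhoff sum of the formal coboundary of [sum_j wave q j]. *)
Definition coc_term (q : nat -> Z) (n : nat) (x : R) (j : nat) : R :=
  2 ^ (S j) * (wave q j (x + INR n * alpha) - wave q j x).
Definition coc (q : nat -> Z) (n : nat) (x : R) : R := dy (coc_term q n x).

Lemma sgn_odd_mul q k : Z.odd q = true -> sgn (q * k) = sgn k.
Proof.
intros H. unfold sgn. rewrite Z.even_mul, <- Z.negb_odd, H. reflexivity.
Qed.

(** Odd frequencies enter here: [q j * k] has the parity of [k]. *)
Lemma wave_halves q j x k : Z.odd (q j) = true -> wave q j (x + IZR k / 2) = sgn k * wave q j x.
Proof.
intros H. unfold wave.
replace (IZR (q j) * (x + IZR k / 2)) with (IZR (q j) * x + IZR (q j * k) / 2)
  by (rewrite mult_IZR; field).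
rewrite tri_halves, sgn_odd_mul by trivial. ring.
Qed.

Lemma wave_periodic q j x k : wave q j (x + IZR k) = wave q j x.
Proof.
unfold wave. rewrite Rmult_plus_distr_l, <- mult_IZR, tri_periodic. reflexivity.
Qed.

Lemma waves_periodic q j x k : waves q j (x + IZR k) = waves q j x.
Proof. induction j as [|j IH]; simpl; [reflexivity|]. now rewrite IH, wave_periodic. Qed.

(** * Continuity and density of orbits for the cocycle [coc] *)

Section Frequencies.

Context {q p : nat -> Z} {L : nat -> R} {M : nat -> nat} (fr : frequencies q p L M).

Lemma fr_q_pos i : 1 <= IZR (q i).
Proof. apply Rle_trans with (2 := fr_q _ _ _ _ fr i). apply pow_R1_Rle; lra. Qed.

Lemma wave_lip j x x' : Rabs (wave q j x' - wave q j x) <= 2 * IZR (q j) * Rabs (x' - x).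
Proof.
unfold wave. rewrite <- Rmult_minus_distr_l, Rabs_mult, (Rabs_pos_eq 2), Rmult_assoc by lra.
apply Rmult_le_compat_l; [lra|].
rewrite <- (Rabs_pos_eq (IZR (q j))) at 3 by (generalize (fr_q_pos j); lra).
rewrite <- Rabs_mult, Rmult_minus_distr_l. apply tri_lip.
Qed.

Lemma waves_lip j x x' : Rabs (waves q j x' - waves q j x) <= L j * Rabs (x' - x).
Proof.
induction j as [|j IH]; simpl.
- rewrite (fr_L0 _ _ _ _ fr), Rminus_0_r, Rabs_R0. lra.
- rewrite (fr_LS _ _ _ _ fr).
  replace (waves q j x' + wave q j x' - (waves q j x + wave q j x))
    with (waves q j x' - waves q j x + (wave q j x' - wave q j x)) by ring.
  generalize (Rabs_triang (waves q j x' - waves q j x) (wave q j x' - wave q j x))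
    (wave_lip j x x'). lra.
Qed.

Lemma L_nonneg j : 0 <= L j.
Proof.
induction j as [|j IH]; [rewrite (fr_L0 _ _ _ _ fr) | rewrite (fr_LS _ _ _ _ fr)].
- lra.
- generalize (fr_q_pos j). lra.
Qed.

Lemma M_mono k j : (k <= j)%nat -> (M k <= M j)%nat.
Proof. induction 1 as [|j _ IH]; [lia|]. generalize (fr_M _ _ _ _ fr j). lia. Qed.

(** Modulo the integer [n * p j], the argument of [tri] moves only by [n] times the approximation
    error. *)
Lemma wave_drift n j x : Rabs (wave q j (x + INR n * alpha) - wave q j x) <=
  2 * INR n * (IZR (q j) * alpha - IZR (p j)).
Proof.
assert (P := fr_pos _ _ _ _ fr j). assert (N := pos_INR n).
unfold wave.
rewrite <- Rmult_minus_distr_l, Rabs_mult, (Rabs_pos_eq 2), Rmult_assoc by lra.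
apply Rmult_le_compat_l; [lra|].
rewrite <- (tri_periodic _ (- (Z.of_nat n * p j))).
rewrite opp_IZR, mult_IZR, <- INR_IZR_INZ.
apply Rle_trans with (1 := tri_lip _ _).
right. rewrite <- (Rabs_pos_eq (INR n * (IZR (q j) * alpha - IZR (p j)))) by nra.
f_equal. ring.
Qed.

(** By [wave_drift] and [fr_small] the term is at most n / (M j + 1). In particular, up to time
    [M k] all terms from index [k] on are bounded by 1. *)
Lemma coc_term_bound n k j x : (k <= j)%nat ->
  Rabs (coc_term q n x j) * (INR (M k) + 1) <= INR n.
Proof.
intros H. unfold coc_term. rewrite Rabs_mult.
assert (P : 0 < 2 ^ S j) by (apply pow_lt; lra).
rewrite (Rabs_pos_eq (2 ^ S j)) by lra.
assert (K := le_INR _ _ (M_mono k j H)). assert (N := pos_INR n). assert (N' := pos_INR (M k)).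
assert (D := wave_drift n j x). assert (D' := fr_small _ _ _ _ fr j).
assert (Dp := fr_pos _ _ _ _ fr j).
replace (2 ^ (j + 2)) with (2 * 2 ^ S j) in D' by (rewrite pow_add; simpl; ring).
set (d := IZR (q j) * alpha - IZR (p j)) in *.
set (w := Rabs _) in *. set (P2 := 2 ^ S j) in *.
apply Rle_trans with (P2 * (2 * INR n * d) * (INR (M j) + 1)).
- apply Rmult_le_compat; try nra.
  apply Rmult_le_pos; [lra | apply Rabs_pos].
- replace (P2 * (2 * INR n * d) * (INR (M j) + 1))
    with (INR n * (2 * P2 * (INR (M j) + 1) * d)) by ring.
  rewrite <- (Rmult_1_r (INR n)) at 2. now apply Rmult_le_compat_l.
Qed.

Lemma coc_term_bdd n x : bdd (INR n) (coc_term q n x).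
Proof.
intros j. generalize (coc_term_bound n j j x (Nat.le_refl j)) (pos_INR (M j))
  (Rabs_pos (coc_term q n x j)). nra.
Qed.

(** The powers of 2 in [coc_term] cancel the weights of [dy], so the first [k] terms add up to a
    genuine coboundary. The tail is kept as a scaled mean, ready for [dy_bound]. *)
Lemma coc_split n k x : coc q n x = waves q k (x + INR n * alpha) - waves q k x +
  (1/2) ^ k * dy (fun j => coc_term q n x (k + j)).
Proof.
induction k as [|k IH].
- simpl. unfold coc. rewrite (dy_ext _ (fun j => coc_term q n x (0 + j))) by reflexivity. simpl; ring.
- rewrite IH, (dy_shift (INR n)) by (intros j; apply coc_term_bdd).
  rewrite (dy_ext (fun j => coc_term q n x (S k + j)) (fun j => coc_term q n x (k + S j)))
    by (intros; f_equal; lia).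
  rewrite Nat.add_0_r. unfold coc_term at 1. simpl.
  assert (E : (1/2) ^ k * 2 ^ k = 1).
  { rewrite <- Rpow_mult_distr. replace (1/2 * 2) with 1 by field. apply pow1. }
  set (W := wave q k (x + INR n * alpha) - wave q k x).
  set (T := dy _).
  replace ((1/2) ^ k * (2 * 2 ^ k * W / 2 + T / 2))
    with ((1/2) ^ k * 2 ^ k * W + 1/2 * (1/2) ^ k * T) by field.
  rewrite E. unfold W. ring.
Qed.

(** After [coc_split], two tails and two increments of [waves q k] remain, each made smaller than
    [eta / 4]: first [k] is fixed for the tails, then [delta] for the Lipschitz constant [L k]. *)
Lemma coc_cont n x eta : 0 < eta -> exists delta, 0 < delta /\
  forall x', Rabs (x' - x) < delta -> Rabs (coc q n x' - coc q n x) < eta.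
Proof.
intros H. assert (N := pos_INR n).
destruct (half_pow_small (eta / (4 * (INR n + 1)))) as [k Hk].
{ apply Rdiv_lt_0_compat; lra. }
specialize (Hk k (Nat.le_refl k)). assert (HL := L_nonneg k).
assert (Pk : 0 <= (1/2) ^ k) by (apply pow_le; lra).
apply (Rmult_lt_compat_r (4 * (INR n + 1))) in Hk; [|lra].
unfold Rdiv in Hk at 2. rewrite (Rmult_assoc eta), Rinv_l, Rmult_1_r in Hk by lra.
exists (eta / (4 * (L k + 1))). split; [apply Rdiv_lt_0_compat; lra|].
intros x' Hx.
apply (Rmult_lt_compat_r (4 * (L k + 1))) in Hx; [|lra].
unfold Rdiv in Hx. rewrite (Rmult_assoc eta), Rinv_l, Rmult_1_r in Hx by lra.
rewrite !(coc_split n k).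
generalize (waves_lip k x x') (waves_lip k (x + INR n * alpha) (x' + INR n * alpha)).
replace (x' + INR n * alpha - (x + INR n * alpha)) with (x' - x) by ring.
assert (T : forall y, Rabs ((1/2) ^ k * dy (fun j => coc_term q n y (k + j))) <= (1/2) ^ k * INR n).
{ intros y. rewrite Rabs_mult, (Rabs_pos_eq ((1/2) ^ k)) by trivial.
  apply Rmult_le_compat_l; trivial. apply dy_bound. intros j. apply coc_term_bdd. }
generalize (T x) (T x').
assert (Hd := Rabs_pos (x' - x)).
intros T1 T2 W1 W2.
apply Rabs_le_between in T1. apply Rabs_le_between in T2.
apply Rabs_le_between in W1. apply Rabs_le_between in W2.
apply Rabs_def1; nra.
Qed.

Lemma coc_0 x : coc q 0 x = 0.
Proof.
rewrite <- (dy_const 0). apply dy_ext. intros j. unfold coc_term.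
replace (x + INR 0 * alpha) with x by (simpl; ring). ring.
Qed.

Lemma coc_S n x : coc q (S n) x = coc q 1 x + coc q n (x + alpha).
Proof.
unfold coc. rewrite <- (dy_plus (INR 1) (INR n)) by apply coc_term_bdd.
apply dy_ext. intros j. unfold coc_term. rewrite S_INR.
replace (x + (INR n + 1) * alpha) with (x + alpha + INR n * alpha) by ring.
replace (x + INR 1 * alpha) with (x + alpha) by (simpl; ring). ring.
Qed.

Lemma coc_halves n x k : coc q n (x + IZR k / 2) = sgn k * coc q n x.
Proof.
unfold coc. rewrite <- dy_scal. apply dy_ext. intros j. unfold coc_term.
replace (x + IZR k / 2 + INR n * alpha) with (x + INR n * alpha + IZR k / 2) by ring.
rewrite !wave_halves by apply (fr_odd _ _ _ _ fr). ring.
Qed.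

(** Wave [i] oscillates so fast that close to [x1] there is a point [x2] where it has exactly the
    value that corrects the height modulo 1. The orbit is brought near [x2] by time [M (S i)], when
    the tail of the cocycle is still small. *)
Lemma coc_dense x0 y0 x1 y1 eps : 0 < eps -> exists (m : nat) (k n : Z),
  Rabs (x0 + INR m * alpha - x1 - IZR k) < eps /\ Rabs (y0 + coc q m x0 - y1 - IZR n) < eps.
Proof.
intros H. destruct (half_pow_small (eps / 4)) as [i Hi]; [lra|].
specialize (Hi i (Nat.le_refl i)).
assert (P : 0 < 2 ^ i) by (apply pow_lt; lra).
assert (Pi : (1/2) ^ i = / 2 ^ i).
{ rewrite <- pow_inv. f_equal. field. }
assert (Pp : 0 < / 2 ^ i) by now apply Rinv_0_lt_compat.
assert (Q := fr_q _ _ _ _ fr i). assert (Q1 := fr_q_pos i). assert (QL := fr_qL _ _ _ _ fr i).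
assert (LS := fr_LS _ _ _ _ fr i). assert (Li := L_nonneg i).
(* The value wanted from wave [i]; [w] below is its representative in [-1/2, 1/2]. *)
set (b := y1 - (y0 - waves q (S i) x0) - waves q i x1).
destruct (dZ_attained b) as [n [En Hn]]. rewrite En in Hn.
set (w := b - IZR n) in *.
(* Wave [i] equals [w] where [q i * x] is [w / 2] plus an integer. Taking the integer nearest to [c]
   puts [x2] within half a period of [x1]. *)
set (c := IZR (q i) * x1 - w / 2).
destruct (dZ_attained c) as [l [El Hl]]. rewrite El in Hl.
set (x2 := (w / 2 + IZR l) / IZR (q i)).
assert (Hx2 : Rabs (x2 - x1) * IZR (q i) <= 1/2).
{ rewrite <- (Rabs_pos_eq (IZR (q i))) at 1 by lra. rewrite <- Rabs_mult, <- Rabs_Ropp.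
  replace (- ((x2 - x1) * IZR (q i))) with (c - IZR l); trivial.
  unfold x2, c. field. lra. }
assert (Hw : wave q i x2 = w).
{ unfold wave, x2. replace (IZR (q i) * ((w / 2 + IZR l) / IZR (q i))) with (w / 2 + IZR l)
    by (field; lra).
  rewrite tri_periodic, tri_id; [field|].
  unfold Rdiv. rewrite Rabs_mult, (Rabs_pos_eq (/ 2)) by lra. lra. }
destruct (fr_dense _ _ _ _ fr i x0 x2) as (m & k & Hm & Hk).
exists m, k, (- n)%Z. rewrite opp_IZR.
set (x3 := x0 + INR m * alpha) in *.
assert (Hx21 : Rabs (x2 - x1) <= / 2 ^ i).
{ apply Rmult_le_reg_r with (2 ^ i); trivial. rewrite Rinv_l by lra.
  generalize (Rabs_pos (x2 - x1)). nra. }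
assert (HLS : 0 < L (S i)) by lra.
rewrite Rinv_mult in Hk.
assert (Hd := Rabs_pos (x3 - x2 - IZR k)).
assert (Hk1 : L (S i) * Rabs (x3 - x2 - IZR k) <= / 2 ^ i).
{ apply (Rmult_lt_compat_l (L (S i))) in Hk; trivial.
  replace (L (S i) * (/ 2 ^ i * / L (S i))) with (/ 2 ^ i) in Hk by (field; lra). lra. }
split.
- assert (Rabs (x3 - x2 - IZR k) <= / 2 ^ i).
  { apply Rle_trans with (2 := Hk1). nra. }
  generalize (Rabs_triang (x3 - x2 - IZR k) (x2 - x1)).
  replace (x3 - x2 - IZR k + (x2 - x1)) with (x3 - x1 - IZR k) by ring. lra.
- rewrite (coc_split m (S i)). fold x3.
  assert (T : Rabs ((1/2) ^ S i * dy (fun j => coc_term q m x0 (S i + j))) <= (1/2) ^ i).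
  { rewrite Rabs_mult, (Rabs_pos_eq ((1/2) ^ S i)) by (apply pow_le; lra).
    assert (Rabs (dy (fun j => coc_term q m x0 (S i + j))) <= 1).
    { apply dy_bound. intros j.
      assert (B := coc_term_bound m (S i) (S i + j) x0 ltac:(lia)).
      apply le_INR in Hm. generalize (Rabs_pos (coc_term q m x0 (S i + j))) (pos_INR (M (S i))).
      nra. }
    simpl pow. rewrite Pi. nra. }
  set (tail := (1/2) ^ S i * _) in *.
  assert (W1 := waves_lip (S i) (x2 + IZR k) x3). rewrite waves_periodic in W1.
  replace (x3 - (x2 + IZR k)) with (x3 - x2 - IZR k) in W1 by ring.
  assert (W2 := waves_lip i x1 x2).
  assert (W3 : L i * Rabs (x2 - x1) <= / 2 ^ i).
  { apply Rmult_le_reg_r with (2 ^ i); trivial. rewrite Rinv_l by lra.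
    generalize (Rabs_pos (x2 - x1)). nra. }
  assert (E : waves q (S i) x2 = waves q i x2 + w) by (simpl; now rewrite Hw).
  replace (y0 + (waves q (S i) x3 - waves q (S i) x0 + tail) - y1 - - IZR n)
    with ((waves q (S i) x3 - waves q (S i) x2) + (waves q i x2 - waves q i x1) + tail)
    by (rewrite E; unfold w, b; ring).
  apply Rabs_le_between in T.
  apply Rabs_le_between in W1. apply Rabs_le_between in W2.
  rewrite Pi in T, Hi. apply Rabs_def1; lra.
Qed.

End Frequencies.

(** Here [g n] is the [n]-th Birkhoff sum of [g 1]. The field [mc_halves] is equivariance under the
    deck group, and [mc_dense] is density of every forward orbit of the skew rotation. *)
Record minimal_cocycle (g : nat -> R -> R) : Prop := {
  mc_0 : forall x, g O x = 0;
  mc_S : forall n x, g (S n) x = g 1%nat x + g n (x + alpha);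
  mc_cont : forall n x eta, 0 < eta -> exists delta, 0 < delta /\
    forall x', Rabs (x' - x) < delta -> Rabs (g n x' - g n x) < eta;
  mc_halves : forall n x k, g n (x + IZR k / 2) = sgn k * g n x;
  mc_dense : forall x0 y0 x1 y1 eps, 0 < eps -> exists (m : nat) (k n : Z),
    Rabs (x0 + INR m * alpha - x1 - IZR k) < eps /\
    Rabs (y0 + g m x0 - y1 - IZR n) < eps }.

Lemma minimal_cocycle_exists : exists g, minimal_cocycle g.
Proof.
destruct frequencies_exist as (q & p & L & M & fr). exists (coc q). split.
- apply coc_0.
- apply (coc_S fr).
- apply (coc_cont fr).
- apply (coc_halves fr).
- apply (coc_dense fr).
Qed.

(** * Blowing up the backward orbit of a point *)

(* The map [s |-> s - slope x * tri s] is an increasing homeomorphism unless [slope x = 1],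
   that is, [x] is in [Z/2]; then it collapses [-1/4, 1/4]. *)
Definition slope (x : R) : R := 1 - dZ (2 * x).

Lemma slope_bounds x : 1/2 <= slope x <= 1.
Proof. unfold slope. generalize (dZ_bounds (2 * x)). lra. Qed.

Lemma slope_lip x x' : Rabs (slope x' - slope x) <= 2 * Rabs (x' - x).
Proof.
unfold slope. generalize (dZ_lip (2 * x') (2 * x)).
replace (2 * x - 2 * x') with (2 * (x - x')) by ring.
rewrite Rabs_mult, (Rabs_pos_eq 2), (Rabs_minus_sym x) by lra.
now replace (1 - dZ (2 * x') - (1 - dZ (2 * x))) with (dZ (2 * x) - dZ (2 * x')) by ring.
Qed.

Lemma slope_halves x k : slope (x + IZR k / 2) = slope x.
Proof.
unfold slope. replace (2 * (x + IZR k / 2)) with (2 * x + IZR k) by field.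
now rewrite dZ_periodic.
Qed.

Lemma slope_1 x : slope x = 1 -> exists k, 2 * x = IZR k.
Proof. unfold slope. intros H. apply dZ_zero. lra. Qed.

(** * The scalar equation [e = c * tri (z + e)] and its dependence on [c] and [z] *)

Section Scalar.

Context {c c' z z' e e' : R} (Hc : 0 <= c <= 1) (E : e = c * tri (z + e)) (E' : e' = c' * tri (z' + e')).

(** With [s = z + e] one has [z = s - c * tri s], which grows at rate at least [1 - c] because [tri]
    is 1-Lipschitz. Changing [c] costs at most the change itself. *)
Lemma scalar_le : z + e <= z' + e' ->
  (1 - c) * (z' + e' - (z + e)) - Rabs (c' - c) <= z' - z.
Proof.
intros H.
assert (K : e' - e <= c * (z' + e' - (z + e)) + Rabs (c' - c)).
{ replace (e' - e) with (c * (tri (z' + e') - tri (z + e)) + (c' - c) * tri (z' + e'))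
    by lra.
  generalize (tri_lip (z + e) (z' + e')). rewrite (Rabs_pos_eq (z' + e' - _)) by lra.
  intros T. apply Rabs_le_between in T.
  assert (T2 : Rabs ((c' - c) * tri (z' + e')) <= Rabs (c' - c)).
  { rewrite Rabs_mult. generalize (tri_bound (z' + e')) (Rabs_pos (c' - c)). nra. }
  apply Rabs_le_between in T2. nra. }
lra.
Qed.

Lemma scalar_dist_base : Rabs (z' - z) <= 2 * Rabs (z' + e' - (z + e)) + Rabs (c' - c).
Proof.
assert (K : Rabs (e' - e) <= Rabs (z' + e' - (z + e)) + Rabs (c' - c)).
{ replace (e' - e) with (c * (tri (z' + e') - tri (z + e)) + (c' - c) * tri (z' + e'))
    by lra.
  apply Rle_trans with (1 := Rabs_triang _ _).
  rewrite !Rabs_mult, (Rabs_pos_eq c) by lra.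
  generalize (tri_lip (z + e) (z' + e')) (tri_bound (z' + e')) (Rabs_pos (c' - c))
    (Rabs_pos (z' + e' - (z + e))) (Rabs_pos (tri (z' + e') - tri (z + e))). nra. }
replace (z' - z) with ((z' + e' - (z + e)) + - (e' - e)) by ring.
apply Rle_trans with (1 := Rabs_triang _ _). rewrite Rabs_Ropp. lra.
Qed.

End Scalar.

Lemma scalar_ge c c' z z' e e' eta : 0 <= c < 1 -> e = c * tri (z + e) -> e' = c' * tri (z' + e') ->
  0 <= eta -> - eta <= z' - z -> - ((eta + Rabs (c' - c)) / (1 - c)) <= z' + e' - (z + e).
Proof.
intros Hc E E' H Hz.
assert (N := Rabs_pos (c' - c)).
assert (Q : 0 <= (eta + Rabs (c' - c)) / (1 - c)) by (apply Rdiv_le_0_compat; lra).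
destruct (Rle_dec (z + e) (z' + e')) as [K|K]; [lra|].
(* Both solutions are negated rather than exchanged: [scalar_le] then keeps the factor [1 - c],
   whereas an exchange would produce [1 - c'], which may vanish. *)
assert (F : forall c z e, e = c * tri (z + e) -> - e = c * tri (- z + - e)).
{ intros c1 z1 e1 H1. rewrite <- Ropp_plus_distr, tri_opp. lra. }
assert (S := scalar_le (conj (proj1 Hc) (Rlt_le _ _ (proj2 Hc))) (F _ _ _ E) (F _ _ _ E') ltac:(lra)).
assert (S2 : (1 - c) * (z + e - (z' + e')) <= eta + Rabs (c' - c)) by lra.
assert (z + e - (z' + e') <= (eta + Rabs (c' - c)) / (1 - c)); [|lra].
apply Rle_div_r; lra.
Qed.

Lemma scalar_exists c z : 0 <= c <= 1 -> exists e, e = c * tri (z + e).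
Proof.
intros Hc.
destruct (IVT_gen (fun s => s - c * tri s) (z - 1) (z + 1) z) as [s [_ Hs]].
- assert (continuity tri).
  { intros s eps He. exists eps. split; [exact He|]. intros s' [_ Hs].
    simpl in *. unfold Rdist in *. eapply Rle_lt_trans; [apply tri_lip | exact Hs]. }
  intros s. apply continuity_pt_minus.
  + apply derivable_continuous_pt, derivable_pt_id.
  + apply continuity_pt_scal. apply H.
- assert (T : forall s, Rabs (c * tri s) <= 1/4).
  { intros s. rewrite Rabs_mult, (Rabs_pos_eq c) by lra.
    generalize (tri_bound s) (Rabs_pos (tri s)). nra. }
  assert (T1 := T (z - 1)). assert (T2 := T (z + 1)).
  apply Rabs_le_between in T1. apply Rabs_le_between in T2.
  rewrite Rmin_left, Rmax_right by lra. lra.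
- exists (s - z). replace (z + (s - z)) with s by ring. lra.
Qed.

Lemma common_delta (Q : nat -> R -> Prop) :
  (forall n d d', 0 < d' <= d -> Q n d -> Q n d') ->
  (forall n, exists d, 0 < d /\ Q n d) ->
  forall N, exists d, 0 < d /\ forall n, (n < N)%nat -> Q n d.
Proof.
intros mono H. induction N as [|N [d [D K]]].
- exists 1. split; [lra | lia].
- destruct (H N) as [d' [D' K']]. exists (Rmin d d'). split; [now apply Rmin_glb_lt|].
  intros n Hn. destruct (Nat.eq_dec n N) as [->|Ne].
  + apply mono with d'; trivial. split; [now apply Rmin_glb_lt | apply Rmin_r].
  + apply mono with d; [|apply K; lia]. split; [now apply Rmin_glb_lt | apply Rmin_l].
Qed.

(** At such an index the collapsing map is injective, so the base point determines the entry
    [e n]. *)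
Definition good_at (x : R) (n : nat) : Prop := slope (x + INR n * alpha) < 1.

(** Two visits to Z/2 at different times would make a nonzero integer multiple of [alpha] an
    integer. *)
Lemma bad_unique x n m : ~ good_at x n -> ~ good_at x m -> n = m.
Proof.
assert (L : forall n m, ~ good_at x n -> ~ good_at x m -> ~ (n < m)%nat).
{ unfold good_at. intros n' m' Hn Hm Lt.
  destruct (slope_1 (x + INR n' * alpha)) as [k Hk].
  { generalize (slope_bounds (x + INR n' * alpha)). lra. }
  destruct (slope_1 (x + INR m' * alpha)) as [l Hl].
  { generalize (slope_bounds (x + INR m' * alpha)). lra. }
  apply (alpha_irrational (2 * (Z.of_nat m' - Z.of_nat n')) (l - k)); [lia|].
  rewrite mult_IZR, !minus_IZR, <- !INR_IZR_INZ, <- Hk, <- Hl. ring. }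
intros Hn Hm. generalize (L n m Hn Hm) (L m n Hm Hn). lia.
Qed.

Lemma mostly_good x : exists n0, forall n, n <> n0 -> good_at x n.
Proof.
destruct (classic (exists n, ~ good_at x n)) as [[n0 H]|H].
- exists n0. intros n Hn. apply NNPP. intros K. apply Hn. exact (bad_unique x n n0 K H).
- exists O. intros n _. apply NNPP. intros K. apply H. now exists n.
Qed.

Lemma good_dense x eps : 0 < eps -> exists x', Rabs (x' - x) < eps /\ forall n, good_at x' n.
Proof.
intros H. destruct (rotation_dense eps H) as [M HM].
(* Starting the orbit at [alpha] rather than at 0 keeps the coefficient of [alpha] positive at all
   later times. *)
destruct (HM alpha x) as (m & k & _ & K).
exists (alpha + INR m * alpha - IZR k). split.
{ now replace (alpha + INR m * alpha - IZR k - x) with (alpha + INR m * alpha - x - IZR k) by ring. }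
intros n. apply NNPP. unfold good_at. intros B.
destruct (slope_1 (alpha + INR m * alpha - IZR k + INR n * alpha)) as [l Hl].
{ match type of B with context [slope ?u] => generalize (slope_bounds u) end. lra. }
apply (alpha_irrational (2 * (1 + Z.of_nat m + Z.of_nat n)) (l + 2 * k)); [lia|].
rewrite mult_IZR, !plus_IZR, mult_IZR, <- !INR_IZR_INZ, <- Hl. ring.
Qed.

(** * Fibres of the blow-up and continuity of their coordinates *)

Section Blowup.

Context {g : nat -> R -> R} (Hg : minimal_cocycle g).

(* The points over [(x, y)]: [y + g n x + e n] is sent by the collapsing map at [x + n alpha]
   to [y + g n x], the height of the [n]-th iterate. *)
Definition fibre (x y : R) (e : nat -> R) : Prop :=
  forall n, e n = slope (x + INR n * alpha) * tri (y + g n x + e n).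

Lemma fibre_bdd x y e : fibre x y e -> bdd (1/4) e.
Proof.
intros H n. rewrite H, Rabs_mult.
destruct (slope_bounds (x + INR n * alpha)) as [S1 S2].
rewrite Rabs_pos_eq by lra.
generalize (tri_bound (y + g n x + e n)) (Rabs_pos (tri (y + g n x + e n))). nra.
Qed.

Lemma fibre_shift x y e : fibre x y e -> fibre (x + alpha) (y + g 1%nat x) (fun n => e (S n)).
Proof.
intros H n. rewrite H at 1. rewrite (mc_S _ Hg n x), S_INR.
replace (x + (INR n + 1) * alpha) with (x + alpha + INR n * alpha) by ring.
f_equal. f_equal. ring.
Qed.

Lemma fibre_act x y e k n : fibre x y e ->
  fibre (x + IZR k / 2) (sgn k * y + IZR n) (fun i => sgn k * e i).
Proof.
intros H i. rewrite H at 1. rewrite (mc_halves _ Hg).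
replace (x + IZR k / 2 + INR i * alpha) with (x + INR i * alpha + IZR k / 2) by ring.
rewrite slope_halves.
replace (sgn k * y + IZR n + sgn k * g i x + sgn k * e i)
  with (sgn k * (y + g i x + e i) + IZR n) by ring.
rewrite tri_periodic, tri_sgn. ring.
Qed.

(** This symmetry turns lower estimates into upper ones and conversely, so each estimate is proved
    on one side only. *)
Lemma fibre_opp x y e : fibre x y e -> fibre (x + 1/2) (- y) (fun i => - e i).
Proof.
intros H. generalize (fibre_act x y e 1 0 H). change (sgn 1) with (-1). simpl (IZR 1).
intros K i. generalize (K i).
replace (-1 * y + 0) with (- y) by ring. now replace (-1 * e i) with (- e i) by ring.
Qed.

Lemma good_half x n : good_at x n -> good_at (x + 1/2) n.
Proof.
unfold good_at. replace (x + 1/2 + INR n * alpha) with (x + INR n * alpha + IZR 1 / 2) by (simpl; field).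
now rewrite slope_halves.
Qed.

Lemma slope_orbit_lip n x x' :
  Rabs (slope (x' + INR n * alpha) - slope (x + INR n * alpha)) <= 2 * Rabs (x' - x).
Proof.
generalize (slope_lip (x + INR n * alpha) (x' + INR n * alpha)).
now replace (x' + INR n * alpha - (x + INR n * alpha)) with (x' - x) by ring.
Qed.

Lemma good_lower x y e n eta : fibre x y e -> good_at x n -> 0 < eta -> exists d, 0 < d /\
  forall x' y' e', fibre x' y' e' -> Rabs (x' - x) < d -> - d < y' - y ->
  - eta <= y' + e' n - (y + e n).
Proof.
intros F G H. set (c := slope (x + INR n * alpha)).
assert (C : 1/2 <= c < 1) by (destruct (slope_bounds (x + INR n * alpha)); unfold good_at in G; unfold c; lra).
(* Base and slope errors of [2 * d] each, divided by [1 - c], give [eta / 2]; the change of [g n]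
   fits in the remainder. *)
set (d := eta * (1 - c) / 8).
assert (D : 0 < d) by (unfold d; nra).
assert (D' : d <= eta / 16) by (unfold d; nra).
destruct (mc_cont _ Hg n x d D) as [d1 [D1 K]].
exists (Rmin d d1). split; [now apply Rmin_glb_lt|].
intros x' y' e' F' Hx Hy.
assert (M1 := Rmin_l d d1). assert (M2 := Rmin_r d d1).
specialize (K x' ltac:(lra)). apply Rabs_def2 in K.
assert (S : _ -> _ -> _) by exact (scalar_ge c _ _ _ _ _ (2 * d) ltac:(lra) (F n) (F' n)).
specialize (S ltac:(lra) ltac:(lra)).
assert (T := slope_orbit_lip n x x'). fold c in T.
assert (B : (2 * d + Rabs (slope (x' + INR n * alpha) - c)) / (1 - c) <= eta / 2).
{ apply Rle_div_l; [lra|]. unfold d in *. nra. }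
lra.
Qed.

Lemma good_close x y e n eta : fibre x y e -> good_at x n -> 0 < eta -> exists d, 0 < d /\
  forall x' y' e', fibre x' y' e' -> Rabs (x' - x) < d -> Rabs (y' - y) < d ->
  Rabs (y' + e' n - (y + e n)) <= eta.
Proof.
intros F G H.
destruct (good_lower x y e n eta F G H) as [d1 [D1 K1]].
destruct (good_lower _ _ _ n eta (fibre_opp _ _ _ F) (good_half _ _ G) H) as [d2 [D2 K2]].
exists (Rmin d1 d2). split; [now apply Rmin_glb_lt|].
intros x' y' e' F' Hx Hy.
assert (M1 := Rmin_l d1 d2). assert (M2 := Rmin_r d1 d2). apply Rabs_def2 in Hy.
specialize (K1 x' y' e' F' ltac:(lra) ltac:(lra)).
specialize (K2 _ _ _ (fibre_opp _ _ _ F')).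
replace (x' + 1/2 - (x + 1/2)) with (x' - x) in K2 by ring.
specialize (K2 ltac:(lra) ltac:(lra)). apply Rabs_le. lra.
Qed.

(** Valid at bad indices too: the collapsing map is nondecreasing even when its slope parameter is
    1. *)
Lemma base_lower x y e n eta : fibre x y e -> 0 < eta -> exists d, 0 < d /\
  forall x' y' e', fibre x' y' e' -> Rabs (x' - x) < d -> eta <= y' + e' n - (y + e n) ->
  - eta < y' - y.
Proof.
intros F H. destruct (mc_cont _ Hg n x (eta / 4)) as [d1 [D1 K]]; [lra|].
exists (Rmin (eta / 4) d1). split; [apply Rmin_glb_lt; lra|].
intros x' y' e' F' Hx Ha.
assert (M1 := Rmin_l (eta / 4) d1). assert (M2 := Rmin_r (eta / 4) d1).
specialize (K x' ltac:(lra)). apply Rabs_def2 in K.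
assert (B := slope_bounds (x + INR n * alpha)).
assert (Hc : 0 <= slope (x + INR n * alpha) <= 1) by lra.
assert (S := scalar_le Hc (F n) (F' n)). specialize (S ltac:(lra)).
assert (T := slope_orbit_lip n x x').
assert (0 <= (1 - slope (x + INR n * alpha)) * (y' + g n x' + e' n - (y + g n x + e n))) by nra.
lra.
Qed.

(** Collapsing is Lipschitz, so any single height [y + e n] controls the base point, at bad indices
    as well. *)
Lemma base_close x y e n eta : fibre x y e -> 0 < eta -> exists d, 0 < d /\
  forall x' y' e', fibre x' y' e' -> Rabs (x' - x) < d -> Rabs (y' + e' n - (y + e n)) < d ->
  Rabs (y' - y) < eta.
Proof.
intros F H. destruct (mc_cont _ Hg n x (eta / 8)) as [d1 [D1 K]]; [lra|].
exists (Rmin (eta / 8) d1). split; [apply Rmin_glb_lt; lra|].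
intros x' y' e' F' Hx Ha.
assert (M1 := Rmin_l (eta / 8) d1). assert (M2 := Rmin_r (eta / 8) d1).
specialize (K x' ltac:(lra)). apply Rabs_def2 in K.
assert (B := slope_bounds (x + INR n * alpha)).
assert (Hc : 0 <= slope (x + INR n * alpha) <= 1) by lra.
assert (S := scalar_dist_base Hc (F n) (F' n)).
assert (T := slope_orbit_lip n x x').
assert (A : Rabs (y' + g n x' + e' n - (y + g n x + e n)) <= eta / 4).
{ apply Rabs_def2 in Ha. apply Rabs_le. lra. }
apply Rabs_le_between in S. apply Rabs_def1; lra.
Qed.

(** The coordinate [t = y + dy e] is the mean of the heights [y + e n]. If the height at [n0] rose
    by [eps], the base could barely fall ([base_lower]), hence neither could the other heights
    ([good_lower]), and [t] would rise by almost [eps] times the weight of [n0]. *)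
Lemma special_upper x y e n0 eps : fibre x y e -> (forall n, n <> n0 -> good_at x n) -> 0 < eps ->
  exists d, 0 < d /\ forall x' y' e', fibre x' y' e' -> Rabs (x' - x) < d ->
  y' + dy e' - (y + dy e) < d -> y' + e' n0 - (y + e n0) < eps.
Proof.
intros F G H.
set (P := (1/2) ^ S n0). assert (HP : 0 < P <= 1/2).
{ unfold P. split; [apply pow_lt; lra|]. simpl.
  generalize (pow_incr (1/2) 1 n0 ltac:(lra)). rewrite pow1. lra. }
set (eta := eps * P / 8). assert (He : 0 < eta <= eps / 16) by (unfold eta; assert (0 < eps * P) by (apply Rmult_lt_0_compat; lra); split; nra).
destruct (half_pow_small eta) as [N HN]; [lra|].
destruct (common_delta (fun n d => n <> n0 -> forall x' y' e', fibre x' y' e' ->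
   Rabs (x' - x) < d -> - d < y' - y -> - eta <= y' + e' n - (y + e n)))
  with (N := (N + S n0)%nat) as [d1 [D1 K1]].
{ intros n d d' Hd K Hn x' y' e' F' Hx Hy. apply K with x'; trivial; lra. }
{ intros n. destruct (Nat.eq_dec n n0) as [E|E].
  - exists 1. split; [lra | contradiction].
  - destruct (good_lower x y e n eta F (G n E)) as [d [D K]]; [lra|]. exists d. tauto. }
(* The bound 1/2 yields increments of at least -1 for [dy_lower_except], [eps] lets [base_lower]
   apply to the supposed rise, and [d1] feeds the estimates at good indices. *)
set (zeta := Rmin (1/2) (Rmin eps d1)).
assert (Z1 := Rmin_l (1/2) (Rmin eps d1)). assert (Z2 := Rmin_r (1/2) (Rmin eps d1)).
assert (Z3 := Rmin_l eps d1). assert (Z4 := Rmin_r eps d1). fold zeta in Z1, Z2.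
assert (Z0 : 0 < zeta) by (unfold zeta; repeat apply Rmin_glb_lt; lra).
destruct (base_lower x y e n0 zeta F Z0) as [d2 [D2 K2]].
exists (Rmin eta (Rmin d1 d2)). split; [repeat apply Rmin_glb_lt; lra|].
intros x' y' e' F' Hx Ht.
assert (M1 := Rmin_l eta (Rmin d1 d2)). assert (M2 := Rmin_r eta (Rmin d1 d2)).
assert (M3 := Rmin_l d1 d2). assert (M4 := Rmin_r d1 d2).
apply Rnot_le_lt. intros Bad.
specialize (K2 x' y' e' F' ltac:(lra) ltac:(lra)).
set (a n := (y' - y) + (e' n - e n)).
assert (Ba : bdd (Rabs (y' - y) + (1/4 + 1/4)) a).
{ unfold a. apply (bdd_plus _ _ (fun _ => y' - y) (fun n => e' n - e n)).
  - apply bdd_const.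
  - apply bdd_minus; eapply fibre_bdd; eassumption. }
assert (Da : dy a = y' + dy e' - (y + dy e)).
{ unfold a. rewrite (dy_plus (Rabs (y' - y)) (1/4 + 1/4) (fun _ => y' - y) (fun n => e' n - e n)).
  - rewrite dy_const, (dy_minus (1/4) (1/4)) by (eapply fibre_bdd; eassumption). ring.
  - apply bdd_const.
  - apply bdd_minus; eapply fibre_bdd; eassumption. }
assert (L := dy_lower_except _ (N + S n0) n0 a eta eps Ba ltac:(lra)).
specialize (HN (N + S n0)%nat ltac:(lia)). fold P in L.
assert (eps * P - eta - (1/2) ^ (N + S n0) <= dy a).
{ apply L.
  - intros n. assert (B1 := fibre_bdd _ _ _ F n). assert (B2 := fibre_bdd _ _ _ F' n).
    apply Rabs_le_between in B1. apply Rabs_le_between in B2. unfold a. lra.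
  - lia.
  - intros n Hn Hn0. specialize (K1 n Hn Hn0 x' y' e' F' ltac:(lra) ltac:(lra)). unfold a. lra.
  - unfold a. lra. }
unfold eta in *. lra.
Qed.

Lemma special_close x y e n0 eps : fibre x y e -> (forall n, n <> n0 -> good_at x n) -> 0 < eps ->
  exists d, 0 < d /\ forall x' y' e', fibre x' y' e' -> Rabs (x' - x) < d ->
  Rabs (y' + dy e' - (y + dy e)) < d -> Rabs (y' + e' n0 - (y + e n0)) < eps.
Proof.
intros F G H.
destruct (special_upper x y e n0 eps F G H) as [d1 [D1 K1]].
destruct (special_upper _ _ _ n0 eps (fibre_opp _ _ _ F)
  (fun n Hn => good_half _ _ (G n Hn)) H) as [d2 [D2 K2]].
exists (Rmin d1 d2). split; [now apply Rmin_glb_lt|].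
intros x' y' e' F' Hx Hy.
assert (M1 := Rmin_l d1 d2). assert (M2 := Rmin_r d1 d2). apply Rabs_def2 in Hy.
specialize (K1 x' y' e' F' ltac:(lra) ltac:(lra)).
specialize (K2 _ _ _ (fibre_opp _ _ _ F')).
replace (x' + 1/2 - (x + 1/2)) with (x' - x) in K2 by ring.
assert (O : forall a, dy (fun i => - a i) = - dy a).
{ intros a. rewrite (dy_ext _ (fun n => -1 * a n)) by (intros; ring). rewrite dy_scal. ring. }
rewrite !O in K2. specialize (K2 ltac:(lra) ltac:(lra)). apply Rabs_def1; lra.
Qed.

(** Continuity of the quantity collapsed by the map. If 0 is not the exceptional index, control
    passes from [t] to the height at [n0], from there to [y], and from [y] to the height at the good
    index 0. *)
Lemma height_close x y e eps : fibre x y e -> 0 < eps ->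
  exists d, 0 < d /\ forall x' y' e', fibre x' y' e' -> Rabs (x' - x) < d ->
  Rabs (y' + dy e' - (y + dy e)) < d -> Rabs (y' + e' O - (y + e O)) < eps.
Proof.
intros F H. destruct (mostly_good x) as [n0 G].
destruct (Nat.eq_dec n0 0) as [E|E].
{ subst n0. now apply special_close. }
destruct (good_close x y e O (eps / 2) F (G O (not_eq_sym E))) as [d1 [D1 K1]]; [lra|].
destruct (base_close x y e n0 d1 F D1) as [d2 [D2 K2]].
destruct (special_close x y e n0 d2 F G D2) as [d3 [D3 K3]].
exists (Rmin d1 (Rmin d2 d3)). split; [repeat apply Rmin_glb_lt; lra|].
assert (M1 := Rmin_l d1 (Rmin d2 d3)). assert (M2 := Rmin_r d1 (Rmin d2 d3)).
assert (M3 := Rmin_l d2 d3). assert (M4 := Rmin_r d2 d3).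
intros x' y' e' F' Hx Ht.
specialize (K3 x' y' e' F' ltac:(lra) ltac:(lra)).
specialize (K2 x' y' e' F' ltac:(lra) K3).
specialize (K1 x' y' e' F' ltac:(lra) K2). lra.
Qed.

(** Continuity at distance zero gives uniqueness, even though the base point is not assumed to be
    the same. *)
Lemma height_unique x y e y' e' : fibre x y e -> fibre x y' e' -> y + dy e = y' + dy e' ->
  y + e O = y' + e' O.
Proof.
intros F F' E. apply cond_eq. intros eps He.
destruct (height_close x y' e' eps F' He) as [d [D K]].
apply (K x y e); trivial; [now rewrite Rminus_diag, Rabs_R0 | now rewrite E, Rminus_diag, Rabs_R0].
Qed.

(** Converse control: [t] depends continuously on the base point and the one entry that it may leave
    free. [None] is for points without such an entry. *)
Lemma total_close (n0 : option nat) x y e eps : fibre x y e ->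
  (forall n, n0 <> Some n -> good_at x n) -> 0 < eps ->
  exists d, 0 < d /\ forall x' y' e', fibre x' y' e' -> Rabs (x' - x) < d -> Rabs (y' - y) < d ->
  (forall n, n0 = Some n -> Rabs (e' n - e n) < d) ->
  Rabs (y' + dy e' - (y + dy e)) < eps.
Proof.
intros F G H. destruct (dy_close (eps / 2)) as (N & eta & He & K); [lra|].
destruct (common_delta (fun n d => forall x' y' e', fibre x' y' e' -> Rabs (x' - x) < d ->
   Rabs (y' - y) < d -> (forall n, n0 = Some n -> Rabs (e' n - e n) < d) ->
   Rabs (e' n - e n) <= eta)) with (N := N) as [d1 [D1 K1]].
{ intros n d d' Hd K' x' y' e' F' Hx Hy Hn. apply K' with x' y'; trivial; try lra.
  intros m Hm. specialize (Hn m Hm). lra. }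
{ intros n. destruct (classic (n0 = Some n)) as [E|E].
  - exists eta. split; [exact He|]. intros x' y' e' _ _ _ Hn. left. now apply Hn.
  - destruct (good_close x y e n (eta / 2) F (G n E)) as [d [D K']]; [lra|].
    exists (Rmin (eta / 2) d). split; [apply Rmin_glb_lt; lra|].
    assert (M1 := Rmin_l (eta / 2) d). assert (M2 := Rmin_r (eta / 2) d).
    intros x' y' e' F' Hx Hy _. specialize (K' x' y' e' F' ltac:(lra) ltac:(lra)).
    apply Rabs_def2 in Hy. apply Rabs_le_between in K'. apply Rabs_le. lra. }
exists (Rmin (eps / 2) d1). split; [apply Rmin_glb_lt; lra|].
assert (M1 := Rmin_l (eps / 2) d1). assert (M2 := Rmin_r (eps / 2) d1).
intros x' y' e' F' Hx Hy Hn.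
specialize (K e e' (fibre_bdd _ _ _ F) (fibre_bdd _ _ _ F')).
assert (Q : Rabs (dy e' - dy e) < eps / 2).
{ apply K. intros n Hn'. apply (K1 n Hn' x' y' e' F'); try lra.
  intros m Hm. specialize (Hn m Hm). lra. }
apply Rabs_def2 in Q. apply Rabs_def2 in Hy. apply Rabs_def1; lra.
Qed.

Lemma fibre_over_height x n0 s : exists y e, fibre x y e /\ y + g n0 x + e n0 = s.
Proof.
(* Once the argument [s] of [tri] is prescribed, equation [n0] is explicit in [y]; the other entries
   are then solved for separately. *)
set (y := s - slope (x + INR n0 * alpha) * tri s - g n0 x).
assert (X : forall n, exists e, e = slope (x + INR n * alpha) * tri (y + g n x + e) /\
  (n = n0 -> y + g n x + e = s)).
{ intros n. destruct (Nat.eq_dec n n0) as [->|E].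
  - exists (slope (x + INR n0 * alpha) * tri s).
    assert (Q : y + g n0 x + slope (x + INR n0 * alpha) * tri s = s) by (unfold y; ring).
    now rewrite Q.
  - destruct (scalar_exists (slope (x + INR n * alpha)) (y + g n x)) as [e He].
    { generalize (slope_bounds (x + INR n * alpha)); lra. }
    exists e. split; [exact He | contradiction]. }
exists y, (fun n => proj1_sig (constructive_indefinite_description _ (X n))). split.
- intros n. exact (proj1 (proj2_sig (constructive_indefinite_description _ (X n)))).
- exact (proj2 (proj2_sig (constructive_indefinite_description _ (X n0))) eq_refl).
Qed.

(* Away from the one index [n0] at which the slope may be 1, the sequence is a continuous
   function of the point, so [s = y + g n0 x + e n0] parametrizes the fibre continuously. *)
Lemma fibre_exists x t : exists y e, fibre x y e /\ t = y + dy e.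
Proof.
destruct (mostly_good x) as [n0 G].
assert (X : forall s, exists ye : R * (nat -> R), fibre x (fst ye) (snd ye) /\
  fst ye + g n0 x + snd ye n0 = s).
{ intros s. destruct (fibre_over_height x n0 s) as (y & e & H). now exists (y, e). }
set (Y s := fst (proj1_sig (constructive_indefinite_description _ (X s)))).
set (e s := snd (proj1_sig (constructive_indefinite_description _ (X s)))).
assert (F : forall s, fibre x (Y s) (e s)).
{ intros s. exact (proj1 (proj2_sig (constructive_indefinite_description _ (X s)))). }
assert (Hs : forall s, Y s + g n0 x + e s n0 = s).
{ intros s. exact (proj2 (proj2_sig (constructive_indefinite_description _ (X s)))). }
assert (C : continuity (fun s => Y s + dy (e s))).
{ intros s eps He.
  destruct (total_close (Some n0) x (Y s) (e s) eps (F s)) as [d [D K]]; trivial.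
  { intros n Hn. apply G. congruence. }
  destruct (base_close x (Y s) (e s) n0 (d / 2) (F s)) as [d' [D' K']]; [lra|].
  exists (Rmin d' (d / 2)). split; [apply Rmin_glb_lt; lra|].
  intros s' [_ Hd]. simpl in *. unfold Rdist in *.
  assert (M1 := Rmin_l d' (d / 2)). assert (M2 := Rmin_r d' (d / 2)).
  assert (E : Y s' + e s' n0 - (Y s + e s n0) = s' - s)
    by (generalize (Hs s) (Hs s'); lra).
  assert (B : Rabs (Y s' - Y s) < d / 2).
  { apply (K' x (Y s') (e s')); trivial; [rewrite Rminus_diag, Rabs_R0; lra|].
    rewrite E; lra. }
  apply (K x (Y s') (e s')); trivial; [rewrite Rminus_diag, Rabs_R0; lra | lra |].
  intros n Hn. injection Hn as <-.
  apply Rabs_def2 in Hd. apply Rabs_def2 in B. apply Rabs_def1; lra. }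
(* The function differs from [s - g n0 x] by at most 1/2, so it passes the value [t] between [a - 1]
   and [a + 1]. *)
set (a := t + g n0 x).
assert (B : forall s, Rabs (Y s + dy (e s) - (s - g n0 x)) <= 1/2).
{ intros s. assert (B1 := dy_bound _ _ (fibre_bdd _ _ _ (F s))).
  assert (B2 := fibre_bdd _ _ _ (F s) n0).
  apply Rabs_le_between in B1. apply Rabs_le_between in B2.
  apply Rabs_le. generalize (Hs s). lra. }
assert (B1 := B (a - 1)). assert (B2 := B (a + 1)).
apply Rabs_le_between in B1. apply Rabs_le_between in B2.
destruct (IVT_gen (fun s => Y s + dy (e s)) (a - 1) (a + 1) t) as [s [_ Es]]; trivial.
{ unfold a in *. rewrite Rmin_left, Rmax_right by lra. lra. }
exists (Y s), (e s). auto.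
Qed.

End Blowup.

Arguments fibre : clear implicits.

(** * The map of the Klein bottle *)

(** Required for every representation [y], [e] of [t]; [height_unique] makes this consistent. By
    [dy_shift] the image is the point with base [y + g 1 x] and the shifted sequence. *)
Definition lifts (g : nat -> R -> R) (f : pt -> pt) : Prop :=
  forall x t y e, fibre g x y e -> t = y + dy e ->
  f (x, t) = (x + alpha, 2 * t - (y + e O) + g 1%nat x).

Section Map.

Context {g : nat -> R -> R} (Hg : minimal_cocycle g).

Lemma lift_exists : exists f, lifts g f.
Proof.
assert (X : forall p : pt, exists s, exists y e,
  fibre g (fst p) y e /\ snd p = y + dy e /\ s = y + e O).
{ intros [x t]. destruct (fibre_exists Hg x t) as (y & e & F & E). now exists (y + e O), y, e. }
exists (fun p => (fst p + alpha,
  2 * snd p - proj1_sig (constructive_indefinite_description _ (X p)) + g 1%nat (fst p))).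
intros x t y e F E.
destruct (constructive_indefinite_description _ (X (x, t))) as (s & y' & e' & F' & E' & Es).
simpl in *. now rewrite Es, (height_unique Hg x y e y' e' F F' ltac:(lra)).
Qed.

Context {f : pt -> pt} (Hf : lifts g f).

(** Commutation holds in the plane itself, so continuity can be checked on the representative of [q]
    lying near [p]. *)
Lemma lift_act k n p : f (act k n p) = act k n (f p).
Proof.
destruct p as [x t]. destruct (fibre_exists Hg x t) as (y & e & F & E).
rewrite (Hf x t y e F E), !act_sgn.
assert (F' := fibre_act Hg x y e k n F).
rewrite (Hf _ _ _ _ F').
- rewrite (mc_halves _ Hg). f_equal; ring.
- rewrite dy_scal, E. ring.
Qed.

Lemma lift_kmap : kmap f.
Proof. intros p q (k & n & ->). exists k, n. apply lift_act. Qed.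

Lemma lift_fst p : fst (f p) = fst p + alpha.
Proof.
destruct p as [x t]. destruct (fibre_exists Hg x t) as (y & e & F & E).
now rewrite (Hf x t y e F E).
Qed.

Lemma lift_fiber_preserving : fiber_preserving f.
Proof. intros p q [k H]. exists k. rewrite !lift_fst, H. ring. Qed.

Lemma sum_sqr_small a b d : (a ^ 2 + b ^ 2 < d ^ 2) -> 0 < d -> Rabs a < d /\ Rabs b < d.
Proof.
intros H D. split; apply Rabs_def1; nra.
Qed.

Lemma sum_sqr_lt a b d : Rabs a < d / 2 -> Rabs b < d / 2 -> a ^ 2 + b ^ 2 < d ^ 2.
Proof.
intros A B. rewrite <- (pow2_abs a), <- (pow2_abs b).
generalize (Rabs_pos a) (Rabs_pos b). nra.
Qed.

Lemma lift_continuous : kcontinuous f.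
Proof.
intros [x t] eps He. destruct (fibre_exists Hg x t) as (y & e & F & E).
destruct (height_close Hg x y e (eps / 8) F) as [d1 [D1 K1]]; [lra|].
destruct (mc_cont _ Hg 1%nat x (eps / 8)) as [d2 [D2 K2]]; [lra|].
exists (Rmin (eps / 8) (Rmin d1 d2)). split; [repeat apply Rmin_glb_lt; lra|].
assert (M1 := Rmin_l (eps / 8) (Rmin d1 d2)). assert (M2 := Rmin_r (eps / 8) (Rmin d1 d2)).
assert (M3 := Rmin_l d1 d2). assert (M4 := Rmin_r d1 d2).
intros q (k & n & Hq). exists k, n. cbv zeta in Hq |- *.
rewrite <- lift_act.
destruct (act k n q) as [x' t']. simpl in Hq.
apply sum_sqr_small in Hq; [|repeat apply Rmin_glb_lt; lra]. destruct Hq as [Hx Ht].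
rewrite Rabs_minus_sym in Hx. rewrite Rabs_minus_sym in Ht.
destruct (fibre_exists Hg x' t') as (y' & e' & F' & E').
rewrite (Hf x t y e F E), (Hf x' t' y' e' F' E'). simpl.
specialize (K2 x' ltac:(lra)). rewrite E, E' in Ht.
specialize (K1 x' y' e' F' ltac:(lra) ltac:(lra)). rewrite <- E, <- E' in Ht.
assert (Hx' : Rabs (x' - x) < eps / 8) by lra. assert (Ht' : Rabs (t' - t) < eps / 8) by lra.
apply Rabs_def2 in Hx'. apply Rabs_def2 in Ht'. apply Rabs_def2 in K1. apply Rabs_def2 in K2.
apply (sum_sqr_lt (x + alpha - (x' + alpha))
  (2 * t - (y + e O) + g 1%nat x - (2 * t' - (y' + e' O) + g 1%nat x'))); apply Rabs_def1; lra.
Qed.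

(** The image lies over the skew rotation orbit with some sequence; which one is irrelevant, since
    it will be compared with a point whose fibre has no free entry. *)
Lemma invariant_orbit (A : pt -> Prop) m : (forall p, A p -> A (f p)) ->
  forall x y e, fibre g x y e -> A (x, y + dy e) ->
  exists e', fibre g (x + INR m * alpha) (y + g m x) e' /\
    A (x + INR m * alpha, y + g m x + dy e').
Proof.
intros Inv. induction m as [|m IH]; intros x y e F HA.
- exists e. rewrite (mc_0 _ Hg). simpl.
  replace (x + 0 * alpha) with x by ring. now rewrite Rplus_0_r.
- assert (HA' := Inv _ HA). rewrite (Hf x _ y e F eq_refl) in HA'.
  rewrite (dy_shift (1/4)) in HA' by exact (fibre_bdd _ _ _ F).
  destruct (IH _ _ _ (fibre_shift Hg _ _ _ F)) as [e' H'].
  { eapply eq_ind; [exact HA'|]. f_equal. field. }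
  exists e'. rewrite (mc_S _ Hg m x), S_INR.
  replace (x + (INR m + 1) * alpha) with (x + alpha + INR m * alpha) by ring.
  now rewrite <- (Rplus_assoc y).
Qed.

(* Density of the orbits of the skew rotation lifts to fibres over which the blow-up is
   injective, and these are dense. *)
Lemma lift_minimal : minimal f.
Proof.
intros A _ Cl [[x0 t0] HA] Inv [x t]. apply NNPP. intros NA.
destruct (Cl _ NA) as [eps [He Far]].
(* The target is moved horizontally to [(x1, t)], where base closeness alone gives closeness of the
   heights. *)
destruct (good_dense x (eps / 4)) as [x1 [Hx1 G]]; [lra|].
destruct (fibre_exists Hg x1 t) as (y1 & e1 & F1 & E1).
destruct (total_close Hg None x1 y1 e1 (eps / 4) F1 (fun n _ => G n)) as [d [D K]]; [lra|].
destruct (fibre_exists Hg x0 t0) as (y0 & e0 & F0 & E0). rewrite E0 in HA.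
destruct (mc_dense _ Hg x0 y0 x1 y1 (Rmin (eps / 4) d)) as (m & k & n & Hx & Hy).
{ apply Rmin_glb_lt; lra. }
assert (M1 := Rmin_l (eps / 4) d). assert (M2 := Rmin_r (eps / 4) d).
destruct (invariant_orbit A m Inv x0 y0 e0 F0 HA) as (e' & F' & HA').
apply (Far _) in HA'; [contradiction|].
(* An even index translates by the integer [- k] without reflecting. *)
exists (- (2 * k))%Z, (- n)%Z. cbv zeta. rewrite act_sgn.
assert (F2 := fibre_act Hg _ _ _ (- (2 * k)) (- n) F').
assert (Sg : sgn (- (2 * k)) = 1) by (unfold sgn; rewrite Z.even_opp, Z.even_mul; reflexivity).
rewrite Sg in *. rewrite !opp_IZR, mult_IZR in *.
replace (x0 + INR m * alpha + - (2 * IZR k) / 2) with (x0 + INR m * alpha - IZR k) in * by field.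
specialize (K _ _ _ F2). rewrite dy_scal in K. simpl.
replace (x0 + INR m * alpha - IZR k - x1) with (x0 + INR m * alpha - x1 - IZR k) in K by ring.
replace (1 * (y0 + g m x0) + - IZR n - y1) with (y0 + g m x0 - y1 - IZR n) in K by ring.
specialize (K ltac:(lra) ltac:(lra) ltac:(discriminate)).
assert (Hx' : Rabs (x0 + INR m * alpha - x1 - IZR k) < eps / 4) by lra.
apply Rabs_def2 in Hx'. apply Rabs_def2 in Hx1. apply Rabs_def2 in K.
apply (sum_sqr_lt (x - (x0 + INR m * alpha - IZR k))
  (t - (1 * (y0 + g m x0 + dy e') + - IZR n))); apply Rabs_def1; lra.
Qed.

(* Over the point (0, 0) the entry [e 0] is free in [-1/4, 1/4], and [f] forgets it. *)
Lemma lift_not_invertible : ~ invertible f.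
Proof.
intros (h & Hh & Inv).
assert (X : forall n, exists b, b = slope (0 + INR n * alpha) * tri (0 + g n 0 + b)).
{ intros n. apply scalar_exists. destruct (slope_bounds (0 + INR n * alpha)); lra. }
set (e1 n := proj1_sig (constructive_indefinite_description _ (X n))).
assert (F1 : fibre g 0 0 e1).
{ intros n. exact (proj2_sig (constructive_indefinite_description _ (X n))). }
set (E (b : R) (n : nat) := match n with O => b | _ => e1 n end).
assert (FE : forall b, Rabs b <= 1/4 -> fibre g 0 0 (E b)).
{ intros c Hc [|n]; [simpl | exact (F1 (S n))].
  rewrite (mc_0 _ Hg), !Rmult_0_l, !Rplus_0_l, tri_id by trivial.
  unfold slope. rewrite Rmult_0_r, (dZ_eq 0 0); rewrite Rminus_diag, Rabs_R0; lra. }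
assert (B0 : Rabs 0 <= 1/4) by (rewrite Rabs_R0; lra).
assert (B1 : Rabs (1/4) <= 1/4) by (rewrite Rabs_pos_eq; lra).
assert (Dy : forall b, Rabs b <= 1/4 -> dy (E b) = b / 2 + dy (fun n => e1 (S n)) / 2).
{ intros c Hc. now rewrite (dy_shift (1/4)) by exact (fibre_bdd _ _ _ (FE c Hc)). }
assert (Same : f (0, 0 + dy (E 0)) = f (0, 0 + dy (E (1/4)))).
{ rewrite (Hf _ _ _ _ (FE 0 B0) eq_refl), (Hf _ _ _ _ (FE (1/4) B1) eq_refl).
  rewrite !Dy by trivial. simpl. f_equal. field. }
destruct (proj1 (Inv (0, 0 + dy (E 0)))) as (k & n & H1).
destruct (proj1 (Inv (0, 0 + dy (E (1/4))))) as (k' & n' & H2).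
rewrite <- Same in H2. destruct (h (f (0, 0 + dy (E 0)))) as [u v].
rewrite act_sgn in H1, H2. rewrite !Dy in H1, H2 by trivial.
injection H1 as U1 V1. injection H2 as U2 V2.
(* Equal first coordinates force equal [k], so the two second coordinates differ by an integer; but
   they differ by half of 1/4. *)
assert (k = k') by (apply eq_IZR; lra). subst k'.
assert (Q : IZR (8 * (n' - n)) = IZR 1) by (rewrite mult_IZR, minus_IZR; lra).
apply eq_IZR in Q. lia.
Qed.

End Map.

Theorem theorem1 :
  exists S : pt -> pt,
    kmap S /\ kcontinuous S /\ fiber_preserving S /\ minimal S /\ ~ invertible S.
Proof.
destruct minimal_cocycle_exists as [g Hg]. destruct (lift_exists Hg) as [f Hf].
exists f. split; [|split; [|split; [|split]]].
- exact (lift_kmap Hg Hf).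
- exact (lift_continuous Hg Hf).
- exact (lift_fiber_preserving Hg Hf).
- exact (lift_minimal Hg Hf).
- exact (lift_not_invertible Hg Hf).
Qed.
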